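(* Let $\phi\in\Phi$, $\nu>0$, $f:\mathbb{R}^{n_1\times n_2}\to(-\infty,+\infty]$ proper lsc, $\Omega\subseteq\mathbb{R}^{n_1\times n_2}$ closed, and suppose $\min_{X\in\Omega}\{\nu f(X)+\mathrm{rank}(X)\}$ has a nonempty global optimal solution set. Suppose $f$ is Lipschitz relative to $\Omega$ with constant $L_f>0$ (w.r.t. the Frobenius norm) and that $X^\varrho\in\Omega$ for every $X\in\Omega$ and $\varrho>0$. Let $\bar\varrho=\phi'_-(1)(1-t^* )(1-t_0)^{-1}\nu L_f$. Then the MPEC $$\textstyle (Q)\ \min_{X,W}\{\nu f(X)+\sum_{i=1}^{n_1}\phi(\sigma_i(W)):\ \|X\|_*-\langle W,X\rangle=0,\ \|W\|\le1,\ X\in\Omega\}$$ satisfies: for all $X\in\Omega$, $\|W\|\le1$, $\nu f(X)+\sum_{i}\phi(\sigma_i(W))+\bar\varrho(\|X\|_*-\langle W,X\rangle)$ is at least the optimal value of $(Q)$; and for every $\varrho>\bar\varrho$ the set of global optimal solutions of $\min_{X,W}\{\nu f(X)+\sum_{i=1}^{n_1}\phi(\sigma_i(W))+\varrho(\|X\|_*-\langle W,X\rangle):\ X\in\Omega,\ \|W\|\le1\}$ coincides with that of $(Q)$.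
   Context: $\Phi$ is the family of proper lsc functions $\phi:\mathbb{R}\to(-\infty,+\infty]$ with $\mathrm{int}(\mathrm{dom}\,\phi)\supseteq[0,1]$, convex on $[0,1]$, such that $\min_{t\in[0,1]}\phi(t)=0$ is attained at a (fixed) point $t^*\in[0,1)$, and $\phi(1)=1$; $\phi'_-(1)$ is the left derivative at $1$. $\psi(t)=\phi(t)$ on $[0,1]$, $+\infty$ otherwise; $t_0\in[0,1)$ is a point with $\frac{1}{1-t^*}\in\partial\psi(t_0)$ (convex subdifferential; exists by Lemma A.1). Matrices are $n_1\times n_2$, $n_1\le n_2$; $\sigma_i$ the $i$-th largest singular value; $\|\cdot\|_*$ nuclear norm, $\|\cdot\|$ spectral norm. For $X\in\Omega$ with SVD $X=U[\mathrm{Diag}(\sigma(X))\ 0]V^T$ and $\varrho>0$, $X^\varrho:=U[\mathrm{Diag}(x^\varrho)\ 0]V^T$ where $x^\varrho_i=\sigma_i(X)$ if $\varrho\sigma_i(X)>\phi'_-(1)$ and $x^\varrho_i=0$ otherwise. *)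

(* Defs.v *)
From Stdlib Require Import Reals ClassicalEpsilon.
From mathcomp Require Import all_boot.
Set Implicit Arguments.
Unset Strict Implicit.
Unset Printing Implicit Defensive.
Open Scope R_scope.

Inductive ereal := Fin (x : R) | PInf.

Definition ereal_lt (a : R) (e : ereal) : Prop :=
  match e with Fin x => a < x | PInf => True end.
Definition ereal_le (e1 e2 : ereal) : Prop :=
  match e1, e2 with
  | Fin x, Fin y => x <= y
  | _, PInf => True
  | PInf, Fin _ => False
  end.
(* real part (only used where the value is known to be finite) *)
Definition rpart (e : ereal) : R := match e with Fin x => x | PInf => 0 end.

Definition in01 (t : R) : Prop := 0 <= t <= 1.

Definition lsc_R (phi : R -> ereal) : Prop :=
  forall x a, ereal_lt a (phi x) ->
    exists d, d > 0 /\ forall y, Rabs (y - x) < d -> ereal_lt a (phi y).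

Definition proper_R (phi : R -> ereal) : Prop := exists t, phi t <> PInf.

Definition int_dom_contains01 (phi : R -> ereal) : Prop :=
  forall t, in01 t -> exists d, d > 0 /\
    forall s, Rabs (s - t) < d -> phi s <> PInf.

Definition convex_on01 (phi : R -> ereal) : Prop :=
  forall t s l, in01 t -> in01 s -> 0 <= l <= 1 ->
    rpart (phi (l * t + (1 - l) * s))
      <= l * rpart (phi t) + (1 - l) * rpart (phi s).

Definition in_Phi (phi : R -> ereal) (tstar : R) : Prop :=
  proper_R phi /\ lsc_R phi /\ int_dom_contains01 phi /\ convex_on01 phi /\
  (0 <= tstar < 1) /\ phi tstar = Fin 0 /\
  (forall t, in01 t -> ereal_le (Fin 0) (phi t)) /\
  phi 1 = Fin 1.

Definition is_left_deriv_at1 (phi : R -> ereal) (d : R) : Prop :=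
  forall eps, eps > 0 -> exists del, del > 0 /\
    forall t, 1 - del < t < 1 ->
      phi t <> PInf /\
      Rabs ((rpart (phi t) - rpart (phi 1)) / (t - 1) - d) < eps.

Definition psi_of (phi : R -> ereal) (t : R) : ereal :=
  match Rle_dec 0 t, Rle_dec t 1 with
  | left _, left _ => phi t
  | _, _ => PInf
  end.
Definition in_subdiff (h : R -> ereal) (t0 g : R) : Prop :=
  h t0 <> PInf /\
  forall t, ereal_le (Fin (rpart (h t0) + g * (t - t0))) (h t).

Definition Mat (m n : nat) := 'I_m -> 'I_n -> R.

Definition msum (n : nat) (F : 'I_n -> R) : R := \big[Rplus/0]_(i < n) F i.

Definition frob_inner m n (A B : Mat m n) : R :=
  msum (fun i => msum (fun j => A i j * B i j)).
Definition frob_norm m n (A : Mat m n) : R := sqrt (frob_inner A A).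
Definition msub m n (A B : Mat m n) : Mat m n := fun i j => A i j - B i j.

Definition orthogonal n (U : Mat n n) : Prop :=
  forall i j : 'I_n, msum (fun k => U k i * U k j) = if i == j then 1 else 0.

Definition svd_recon n1 n2 (U : Mat n1 n1) (s : 'I_n1 -> R) (V : Mat n2 n2)
  : Mat n1 n2 :=
  fun i j => msum (fun k : 'I_n1 => msum (fun l : 'I_n2 =>
     U i k * (if (k : nat) == (l : nat) then s k else 0) * V j l)).

Definition is_svd n1 n2 (X : Mat n1 n2) (U : Mat n1 n1) (V : Mat n2 n2)
  (s : 'I_n1 -> R) : Prop :=
  orthogonal U /\ orthogonal V /\
  (forall i j : 'I_n1, (i <= j)%N -> s j <= s i) /\
  (forall i, 0 <= s i) /\
  X = svd_recon U s V.

Definition svd_triple n1 n2 := ((Mat n1 n1 * Mat n2 n2) * ('I_n1 -> R))%type.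

(* a (chosen) SVD of X; exists when n1 <= n2 *)
Definition svd_of n1 n2 (X : Mat n1 n2) : svd_triple n1 n2 :=
  epsilon (inhabits ((fun _ _ => 0, fun _ _ => 0), fun _ => 0) : inhabited (svd_triple n1 n2))
    (fun p => is_svd X p.1.1 p.1.2 p.2).

(* sigma X i = (i+1)-th largest singular value *)
Definition sing n1 n2 (X : Mat n1 n2) : 'I_n1 -> R := (svd_of X).2.

Definition nuc_norm n1 n2 (X : Mat n1 n2) : R := msum (sing X).
Definition spec_norm n1 n2 (X : Mat n1 n2) : R :=
  \big[Rmax/0]_(i < n1) sing X i.

Definition indep_rows n1 n2 (X : Mat n1 n2) (r : nat) : Prop :=
  exists p : 'I_r -> 'I_n1, forall c : 'I_r -> R,
    (forall j, msum (fun k => c k * X (p k) j) = 0) -> forall k, c k = 0.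
Definition rank n1 n2 (X : Mat n1 n2) : nat :=
  \max_(r < n1.+1 | if excluded_middle_informative (indep_rows X r)
                    then true else false) r.

(* X^rho, built from the SVD of X, thresholded at phi'_-(1) = d *)
Definition Xrho n1 n2 (d rho : R) (X : Mat n1 n2) : Mat n1 n2 :=
  let p := svd_of X in
  svd_recon p.1.1
    (fun i => if Rlt_dec d (rho * p.2 i) then p.2 i else 0) p.1.2.

Definition closed_mset n1 n2 (Om : Mat n1 n2 -> Prop) : Prop :=
  forall X, (forall eps, eps > 0 -> exists Y, Om Y /\ frob_norm (msub X Y) < eps) ->
    Om X.

Definition lsc_M n1 n2 (f : Mat n1 n2 -> ereal) : Prop :=
  forall X a, ereal_lt a (f X) ->
    exists d, d > 0 /\ forall Y, frob_norm (msub Y X) < d -> ereal_lt a (f Y).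

Definition proper_M n1 n2 (f : Mat n1 n2 -> ereal) : Prop := exists X, f X <> PInf.

Definition lipschitz_rel n1 n2 (f : Mat n1 n2 -> ereal) (Om : Mat n1 n2 -> Prop)
  (L : R) : Prop :=
  forall X Y, Om X -> Om Y -> exists fx fy,
    f X = Fin fx /\ f Y = Fin fy /\ Rabs (fx - fy) <= L * frob_norm (msub X Y).

Definition rank_obj n1 n2 (nu : R) (f : Mat n1 n2 -> ereal) (X : Mat n1 n2) : ereal :=
  match f X with Fin x => Fin (nu * x + INR (rank X)) | PInf => PInf end.

Definition objQ n1 n2 (nu : R) (f : Mat n1 n2 -> ereal) (phi : R -> ereal)
  (X W : Mat n1 n2) : R :=
  nu * rpart (f X) + msum (fun i => rpart (phi (sing W i))).

Definition feasQ n1 n2 (Om : Mat n1 n2 -> Prop) (X W : Mat n1 n2) : Prop :=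
  Om X /\ spec_norm W <= 1 /\ nuc_norm X - frob_inner W X = 0.

Definition feasP n1 n2 (Om : Mat n1 n2 -> Prop) (X W : Mat n1 n2) : Prop :=
  Om X /\ spec_norm W <= 1.

Definition penobj n1 n2 (nu : R) (f : Mat n1 n2 -> ereal) (phi : R -> ereal)
  (rho : R) (X W : Mat n1 n2) : R :=
  objQ nu f phi X W + rho * (nuc_norm X - frob_inner W X).

Definition optQ n1 n2 nu f phi (Om : Mat n1 n2 -> Prop) (X W : Mat n1 n2) : Prop :=
  feasQ Om X W /\ forall X' W', feasQ Om X' W' -> objQ nu f phi X W <= objQ nu f phi X' W'.

Definition optP n1 n2 nu f phi (Om : Mat n1 n2 -> Prop) rho (X W : Mat n1 n2) : Prop :=
  feasP Om X W /\
  forall X' W', feasP Om X' W' -> penobj nu f phi rho X W <= penobj nu f phi rho X' W'.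

Definition is_optval_Q n1 n2 nu f phi (Om : Mat n1 n2 -> Prop) (v : R) : Prop :=
  (forall X W, feasQ Om X W -> v <= objQ nu f phi X W) /\
  (forall eps, eps > 0 -> exists X W, feasQ Om X W /\ objQ nu f phi X W < v + eps).

(* Main.v *)
(* By von Neumann's trace inequality, [<W, X> <= \sum_i sigma_i(W) sigma_i(X)], so the penalized
   objective at [(X, W)] is at least [nu f(X) + \sum_i (phi(w_i) + rho x_i (1 - w_i))] with
   [x = sigma(X)] and [w = sigma(W)].  A summand is at least [1] when [rho x_i > phi'_-(1)], by
   the tangent line of [phi] at [1]; otherwise, for [rho = rhobar], it is at least [nu Lf x_i],
   by the subgradient at [t0].  Since [|X - X^rho|_F <= \sum_i (x_i - x^rho_i)], the Lipschitz
   bound on [f] shows that [X^rho], paired with a matrix of the same singular vectors and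
   singular values [1] or [tstar], is feasible for (Q) with an objective no larger than the
   penalized one.  Both claims follow because the gap [|X|_* - <W, X>] is nonnegative.  The rank
   problem only serves to make (Q) bounded below. *)

From Stdlib Require Import Reals Lra Classical ClassicalEpsilon FunctionalExtensionality.
From mathcomp Require Import all_boot all_order all_algebra.
From mathcomp Require Import perm complex Rstruct.
From mathcomp Require ring lra.
Require Import Defs.
Set Implicit Arguments.
Unset Strict Implicit.
Unset Printing Implicit Defensive.
Import Order.TTheory GRing.Theory Num.Theory.
Open Scope R_scope.

(** * Existence of the singular value decomposition *)

Section SVD.
Import ring lra.
Local Open Scope ring_scope.
Variable F : rcfType.
Implicit Types m n : nat.

Lemma row_sqnorm_eq0 n (u : 'rV[F]_n) : (u *m u^T) 0 0 = 0 -> u = 0.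
Proof.
rewrite mxE => /eqP; rewrite psumr_eq0; last first.
  by move=> i _; rewrite mxE -expr2 sqr_ge0.
move=> /allP u0; apply/rowP => i; have := u0 i (mem_index_enum _).
by rewrite !mxE -expr2 sqrf_eq0 => /eqP.
Qed.

Lemma row_sqnorm_ge0 n (u : 'rV[F]_n) : 0 <= (u *m u^T) 0 0.
Proof. by rewrite mxE sumr_ge0// => i _; rewrite mxE -expr2 sqr_ge0. Qed.

Lemma row_normalize n (u : 'rV[F]_n) : u != 0 ->
  exists2 a, a != 0 & (a *: u) *m (a *: u)^T = 1%:M.
Proof.
move=> un0; set c := (u *m u^T) 0 0.
have c0 : 0 < c.
  rewrite lt_def row_sqnorm_ge0 andbT; apply: contra un0 => /eqP h.
  by apply/eqP/row_sqnorm_eq0.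
exists (Num.sqrt c)^-1; first by rewrite invr_eq0 sqrtr_eq0 -ltNge.
rewrite linearZ /= -scalemxAl -scalemxAr scalerA [u *m _]mx11_scalar -/c.
by rewrite scale_scalar_mx -expr2 exprVn sqr_sqrtr ?ltW// mulVf ?gt_eqF.
Qed.

Lemma row_dotC n (u v : 'rV[F]_n) : u *m v^T = v *m u^T.
Proof. by rewrite [LHS]mx11_scalar -tr_scalar_mx -mx11_scalar trmx_mul trmxK. Qed.

(** Over the algebraic closure [F[i]] there is an eigenvector [u + i v] with eigenvalue [a].
    Symmetry gives [u A v^T = v A u^T], that is [Im a (|u|^2 + |v|^2) = 0], so [a] is real and
    whichever of [u], [v] is nonzero is a real eigenvector. *)
Lemma sym_eigenvector n (A : 'M[F]_n.+1) : A^T = A ->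
  exists (l : F) (u : 'rV_n.+1), u != 0 /\ u *m A = l *: u.
Proof.
move=> symA.
have [a] := eigenvalue_closed (map_mx (real_complex F) A) (ltn0Sn n).
case/eigenvalueP => z zA zn0.
pose u := map_mx (@complex.Re F) z; pose v := map_mx (@complex.Im F) z.
have entry j : \sum_k z 0 k * (A k j)%:C%C = a * z 0 j.
  by move/rowP: zA => /(_ j); rewrite !mxE => <-; apply: eq_bigr => k _; rewrite mxE.
have ReD := raddf_sum (@complex.Re F : Rcomplex F -> F).
have ImD := raddf_sum (@complex.Im F : Rcomplex F -> F).
have uA : u *m A = complex.Re a *: u - complex.Im a *: v.
  apply/rowP => j; rewrite !mxE.
  transitivity (complex.Re (a * z 0 j)); last by case: a {zA entry} (z 0 j) => ? ? [].
  rewrite -entry ReD; apply: eq_bigr => k _; rewrite mxE.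
  by case: (z 0 k) => x y /=; ring.
have vA : v *m A = complex.Re a *: v + complex.Im a *: u.
  apply/rowP => j; rewrite !mxE.
  transitivity (complex.Im (a * z 0 j)); last by case: a {zA entry uA} (z 0 j) => ? ? [].
  rewrite -entry ImD; apply: eq_bigr => k _; rewrite mxE.
  by case: (z 0 k) => x y /=; ring.
have uv0 : u != 0 \/ v != 0.
  case: (eqVneq u 0) => [u0|]; last by left.
  right; apply: contra zn0 => /eqP v0; apply/eqP/rowP => j; rewrite mxE.
  move/rowP: u0 => /(_ j); move/rowP: v0 => /(_ j); rewrite !mxE.
  by case: (z 0 j) => x y /= -> ->.
have im0 : complex.Im a = 0.
  have : u *m A *m v^T = v *m A *m u^T.
    by rewrite row_dotC trmx_mul symA mulmxA.
  rewrite uA vA mulmxBl mulmxDl -!scalemxAl (row_dotC v u) => /matrixP/(_ 0 0).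
  rewrite [u *m v^T]mx11_scalar [v *m v^T]mx11_scalar [u *m u^T]mx11_scalar.
  move: (row_sqnorm_ge0 u) (row_sqnorm_ge0 v) (@row_sqnorm_eq0 _ u) (@row_sqnorm_eq0 _ v).
  set x := (u *m u^T) 0 0; set y := (v *m v^T) 0 0; set z' := (u *m v^T) 0 0.
  move=> x0 y0 ux vy; rewrite !mxE eqxx !mulr1n => /addrI/eqP.
  rewrite -subr_eq0 -opprD oppr_eq0 -mulrDr mulf_eq0 => /orP[/eqP//|].
  rewrite paddr_eq0// => /andP[/eqP/vy v00 /eqP/ux u00]; exfalso.
  by case: uv0; rewrite ?u00 ?v00 eqxx.
case: uv0 => [h|h]; [exists (complex.Re a), u|exists (complex.Re a), v]; split=> //.
  by rewrite uA im0 scale0r subr0.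
by rewrite vA im0 scale0r addr0.
Qed.

(** Unless [u] is the first basis vector [e], the Householder reflection along [w = u - e] works: it
    is symmetric, squares to the identity and sends [e] to [u]. *)
Lemma orthomx_completion n (u : 'rV[F]_n.+1) : u *m u^T = 1%:M ->
  exists2 Q : 'M_n.+1, Q *m Q^T = 1%:M & row 0 Q = u.
Proof.
move=> u1; pose e : 'rV[F]_n.+1 := delta_mx 0 0.
have e1 : e *m e^T = 1%:M.
  by rewrite trmx_delta mul_delta_mx; apply/matrixP => i j; rewrite !ord1 !mxE.
have [ue|une] := eqVneq u e.
  by exists 1%:M; rewrite ?trmx1 ?mulmx1// ue rowE mulmx1.
pose w := u - e; pose c := (w *m w^T) 0 0.
have wn0 : w != 0 by rewrite subr_eq0.
have cn0 : c != 0 by apply: contra wn0 => /eqP/row_sqnorm_eq0/eqP.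
have ww : w *m w^T = c%:M by rewrite [LHS]mx11_scalar.
have ew : e *m w^T = (- (c / 2))%:M.
  have : c%:M = 1%:M - u *m e^T - (u *m e^T - 1%:M) :> 'M[F]_1.
    rewrite -ww linearB /= mulmxBl !mulmxBr u1 e1 (row_dotC e u).
    by rewrite opprB addrA.
  have -> : e *m w^T = u *m e^T - 1%:M by rewrite linearB mulmxBr e1 row_dotC.
  rewrite [u *m e^T]mx11_scalar => /matrixP/(_ 0 0).
  rewrite !mxE !eqxx !mulr1n => ->; apply/matrixP => i j; rewrite !ord1 !mxE !eqxx !mulr1n.
  by field.
have uE : u = e + w by rewrite addrC subrK.
clearbody w c => {wn0}.
pose Q := 1%:M - (2 / c) *: (w^T *m w).
have QT : Q^T = Q by rewrite /Q linearB linearZ /= trmx_mul trmxK trmx1.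
exists Q.
  rewrite QT /Q mulmxBl mul1mx mulmxBr mulmx1 -scalemxAl -scalemxAr scalerA.
  rewrite mulmxA -(mulmxA w^T) ww mul_mx_scalar -scalemxAl scalerA.
  have -> : 2 / c * (2 / c) * c = 2 / c + 2 / c by field.
  by rewrite scalerDl opprB addrK subrK.
rewrite rowE -/e /Q mulmxBr mulmx1 -scalemxAr mulmxA ew mul_scalar_mx scalerA.
have -> : 2 / c * - (c / 2) = -1 by field.
by rewrite scaleN1r opprK.
Qed.

(* When the eigenvalue of [X X^T] is [0], [m <= n] is what provides [v] in the kernel of [X]. *)
Lemma singular_pair m n (X : 'M[F]_(m.+1, n.+1)) : (m <= n)%N ->
  exists (s : F) (u : 'rV_m.+1) (v : 'rV_n.+1),
    [/\ 0 <= s, u *m u^T = 1%:M, v *m v^T = 1%:M, u *m X = s *: v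
      & v *m X^T = s *: u].
Proof.
move=> mn.
have symXX : (X *m X^T)^T = X *m X^T by rewrite trmx_mul trmxK.
have [l [u0 [u0n0 u0X]]] := sym_eigenvector symXX.
have [a an0 u1] := row_normalize u0n0; set u := a *: u0 in u1.
have uX : u *m X *m X^T = l *: u.
  by rewrite -mulmxA -scalemxAl u0X !scalerA mulrC.
have XX : (u *m X) *m (u *m X)^T = l%:M.
  by rewrite trmx_mul mulmxA uX -scalemxAl u1 scale_scalar_mx mulr1.
have l0 : 0 <= l.
  by move/matrixP: XX => /(_ 0 0); rewrite [in RHS]mxE eqxx mulr1n => <-; exact: row_sqnorm_ge0.
have [lE|ln0] := eqVneq l 0.
  have uX0 : u *m X = 0 by apply: row_sqnorm_eq0; rewrite XX lE !mxE eqxx.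
  (* The nonzero [u] lies in the left kernel of [X], so [X] does not have full row rank. *)
  have rX : (\rank X^T <= m)%N.
    rewrite mxrank_tr -ltnS ltn_neqAle rank_leq_row andbT.
    apply/negP => frX; have : u = 0 by apply: (row_free_inj frX); rewrite uX0 mul0mx.
    move=> u00; move: u1; rewrite u00 mul0mx => /matrixP/(_ 0 0)/eqP.
    by rewrite !mxE eqxx eq_sym oner_eq0.
  have kn0 : kermx X^T != 0.
    by rewrite -mxrank_eq0 mxrank_ker -lt0n subn_gt0 ltnS (leq_trans rX).
  have /rowV0Pn[i vn0 vn1] := kn0.
  have [b bn0 v1] := row_normalize vn1.
  exists 0, u, (b *: i); split=> //; first by rewrite scale0r.
  by rewrite -scalemxAl (sub_kermxP vn0) scaler0 scale0r.
have lp : 0 < l by rewrite lt_def ln0.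
have sn0 : Num.sqrt l != 0 by rewrite sqrtr_eq0 -ltNge.
exists (Num.sqrt l), u, ((Num.sqrt l)^-1 *: (u *m X)); split=> //.
- exact: sqrtr_ge0.
- rewrite linearZ /= -scalemxAl -scalemxAr XX scalerA scale_scalar_mx -expr2 exprVn.
  by rewrite sqr_sqrtr// mulVf.
- by rewrite scalerA divff// scale1r.
- rewrite -scalemxAl uX scalerA; congr (_ *: _).
  by rewrite -{2}(sqr_sqrtr l0) expr2 mulKf.
Qed.

Lemma block_ortho m (U : 'M[F]_m) : U *m U^T = 1%:M ->
  block_mx 1%:M 0 0 U *m (block_mx (1%:M : 'M_1) 0 0 U)^T = 1%:M.
Proof.
move=> U1; rewrite tr_block_mx mulmx_block !trmx0 trmx1 !mul0mx !mulmx0 mulmx1.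
by rewrite !addr0 !add0r U1 -scalar_mx_block.
Qed.

Lemma block_diag_mul m n (s : 'M[F]_1) (U : 'M[F]_m) (X : 'M_(m, n)) (V : 'M_n) :
  block_mx 1%:M 0 0 U *m block_mx s 0 0 X *m (block_mx (1%:M : 'M_1) 0 0 V)^T
  = block_mx s 0 0 (U *m X *m V^T).
Proof.
rewrite tr_block_mx !mulmx_block !trmx0 trmx1 ?(mul0mx, mulmx0, mulmx1, mul1mx).
by rewrite !(addr0, add0r) ?(mul0mx, mulmx0).
Qed.

Lemma block_diag_eq0 m n (s : 'M[F]_1) (D : 'M[F]_(m, n)) :
  (forall (i : 'I_m) (j : 'I_n), i != j :> nat -> D i j = 0) ->
  forall (i : 'I_(1 + m)) (j : 'I_(1 + n)), i != j :> nat -> block_mx s 0 0 D i j = 0.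
Proof.
move=> D0 i j; rewrite -(splitK i) -(splitK j).
case: (split i) => k; case: (split j) => l /=; rewrite ?ord1 ?eqxx//.
- by rewrite block_mxEur mxE.
- by rewrite block_mxEdl mxE.
- by rewrite block_mxEdr !add1n eqSS => /D0.
Qed.

Lemma block_diag_ge0 m n (s : F) (D : 'M[F]_(m, n)) : 0 <= s ->
  (forall i j, 0 <= D i j) -> forall i j, 0 <= block_mx (s%:M : 'M_1) 0 0 D i j.
Proof.
move=> s0 D0 i j; rewrite -(splitK i) -(splitK j).
case: (split i) => k; case: (split j) => l /=.
- by rewrite block_mxEul !ord1 mxE eqxx mulr1n.
- by rewrite block_mxEur mxE.
- by rewrite block_mxEdl mxE.
- by rewrite block_mxEdr.
Qed.

Lemma mulmx_ortho n (U V : 'M[F]_n) : U *m U^T = 1%:M -> V *m V^T = 1%:M ->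
  (U *m V) *m (U *m V)^T = 1%:M.
Proof. by move=> U1 V1; rewrite trmx_mul mulmxA -(mulmxA U) V1 mulmx1. Qed.

(** By induction: complete a singular pair [u], [v] to orthogonal [U0], [V0]. The two relations of
    the pair clear the first row and the first column of [U0 X V0^T] outside the corner [s], and the
    induction hypothesis diagonalizes the remaining block. The diagonal is sorted later. *)
Lemma SVD m n (X : 'M[F]_(m, n)) : (m <= n)%N ->
  exists (U : 'M_m) (V : 'M_n), [/\ U *m U^T = 1%:M, V *m V^T = 1%:M,
    forall (i : 'I_m) (j : 'I_n), i != j :> nat -> (U *m X *m V^T) i j = 0
    & forall i j, 0 <= (U *m X *m V^T) i j].
Proof.
elim: m n X => [|m IH] [|n] X // mn.
- by exists 1%:M, 1%:M; rewrite trmx1 !mulmx1; split=> // -[].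
- by exists 1%:M, 1%:M; rewrite !trmx1 !mulmx1; split=> // -[].
have [s [u [v [s0 u1 v1 uX vX]]]] := singular_pair X mn.
have [U0 U01 rU0] := orthomx_completion u1.
have [V0 V01 rV0] := orthomx_completion v1.
have [M MD] : exists M, M = U0 *m X *m V0^T by eexists.
have M0 j : M 0 j = s *+ (j == 0).
  transitivity ((row 0 M) 0 j); first by rewrite [in RHS]mxE.
  rewrite MD !row_mul rU0 uX -scalemxAl -rV0 -row_mul V01 !mxE eq_sym.
  by case: (j == 0); rewrite ?mulr1 ?mulr0.
have Mi i : M i 0 = s *+ (i == 0).
  transitivity ((row 0 M^T) 0 i); first by rewrite [in RHS]mxE [in RHS]mxE.
  rewrite MD !trmx_mul trmxK mulmxA !row_mul rV0 vX -scalemxAl -rU0 -row_mul U01 !mxE eq_sym.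
  by case: (i == 0); rewrite ?mulr1 ?mulr0.
pose X' := @drsubmx F 1 m 1 n M.
have ME : M = block_mx (s%:M : 'M_1) 0 0 X' :> 'M[F]_(1 + m, 1 + n).
  rewrite -[LHS](@submxK F 1 m 1 n); congr block_mx; apply/matrixP => i j.
  - by rewrite !mxE !ord1 -[RHS](M0 0); congr (M _ _); apply/val_inj.
  - rewrite !mxE !ord1; transitivity (M 0 (rshift 1 j)); last by rewrite M0.
    by congr (M _ _); apply/val_inj.
  - rewrite !mxE !ord1; transitivity (M (rshift 1 i) 0); last by rewrite Mi.
    by congr (M _ _); apply/val_inj.
have [U' [V' [U'1 V'1 D0 Dp]]] := IH _ X' mn.
pose U : 'M_m.+1 := (block_mx (1%:M : 'M_1) 0 0 U' : 'M_m.+1) *m U0.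
pose V : 'M_n.+1 := (block_mx (1%:M : 'M_1) 0 0 V' : 'M_n.+1) *m V0.
have DE : U *m X *m V^T = block_mx (s%:M : 'M_1) 0 0 (U' *m X' *m V'^T).
  rewrite trmx_mul mulmxA -(mulmxA _ U0) -(mulmxA _ _ V0^T) -MD ME.
  exact: block_diag_mul.
exists U, V; split; [exact/mulmx_ortho/U01/block_ortho|exact/mulmx_ortho/V01/block_ortho| |].
  by move=> i j ij; rewrite DE; exact: block_diag_eq0.
by move=> i j; rewrite DE; exact: block_diag_ge0.
Qed.

(** * Von Neumann's trace inequality *)

(** The coefficient of the initial segment up to [p] is the drop of [a] from [p] to [p.+1], and the
    sum telescopes. *)
Lemma layer_cake n (a : 'I_n -> F) :
  (forall i j : 'I_n, (i <= j)%N -> a j <= a i) -> (forall i, 0 <= a i) ->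
  exists2 al : 'I_n -> F, forall p, 0 <= al p
    & forall k : 'I_n, a k = \sum_(p < n) al p * (k <= p)%:R.
Proof.
(* Extending [a] by [0] at index [n] makes the last drop equal to the last value of [a]. *)
move=> a_dec a_ge0; pose b i := if insub i is Some k then a k else 0.
have bE (k : 'I_n) : b k = a k by rewrite /b valK.
have bn : b n = 0 by rewrite /b insubF ?ltnn.
exists (fun p => b p - b p.+1) => [p|k].
  rewrite subr_ge0 bE /b; case: insubP => [j _ jE|_]; last exact: a_ge0.
  by apply: a_dec; rewrite jE.
have -> : a k = - (b n - b k) by rewrite bn bE sub0r opprK.
rewrite -telescope_sumr ?(ltnW (ltn_ord k))// -sumrN big_geq_mkord big_mkcond /=.
by apply: eq_bigr => p _; case: leqP; rewrite ?mulr1 ?mulr0 ?opprB.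
Qed.

(** Both sides are bilinear in [a] and [b], so [layer_cake] reduces the claim to indicators of
    initial segments. There it says that the entries of [D] with [k <= p] and [l <= q] sum to at
    most [min(p, q) + 1]: row sums show this when [p <= q], column sums otherwise. *)
Lemma substochastic_rearrangement n (D : 'I_n -> 'I_n -> F) (a b : 'I_n -> F) :
  (forall k l, 0 <= D k l) ->
  (forall k, \sum_l D k l <= 1) -> (forall l, \sum_k D k l <= 1) ->
  (forall i j : 'I_n, (i <= j)%N -> a j <= a i) -> (forall i, 0 <= a i) ->
  (forall i j : 'I_n, (i <= j)%N -> b j <= b i) -> (forall i, 0 <= b i) ->
  \sum_k \sum_l a k * b l * D k l <= \sum_k a k * b k.
Proof.
move=> D0 Drow Dcol a_dec a_ge0 b_dec b_ge0.
have [al al0 aE] := layer_cake a_dec a_ge0.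
have [be be0 bE] := layer_cake b_dec b_ge0.
have LE : \sum_k \sum_l a k * b l * D k l =
    \sum_p \sum_q al p * be q * \sum_(k < n) \sum_(l < n) (k <= p)%:R * (l <= q)%:R * D k l.
  transitivity (\sum_(k < n) \sum_(p < n) \sum_(l < n) \sum_(q < n)
      al p * be q * ((k <= p)%:R * (l <= q)%:R * D k l)).
    apply: eq_bigr => k _; rewrite [RHS]exchange_big; apply: eq_bigr => l _ /=.
    rewrite aE bE big_distrlr /= mulr_suml; apply: eq_bigr => p _.
    by rewrite mulr_suml; apply: eq_bigr => q _; ring.
  rewrite exchange_big; apply: eq_bigr => p _ /=.
  under eq_bigr do rewrite exchange_big.
  rewrite exchange_big; apply: eq_bigr => q _ /=.
  by rewrite mulr_sumr; apply: eq_bigr => k _; rewrite mulr_sumr.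
have RE : \sum_k a k * b k =
    \sum_p \sum_q al p * be q * \sum_(k < n) (k <= p)%:R * (k <= q)%:R.
  transitivity (\sum_(k < n) \sum_(p < n) \sum_(q < n) al p * be q * ((k <= p)%:R * (k <= q)%:R)).
    apply: eq_bigr => k _; rewrite aE bE big_distrlr /=.
    by apply: eq_bigr => p _; apply: eq_bigr => q _; ring.
  rewrite exchange_big; apply: eq_bigr => p _ /=.
  by rewrite exchange_big; apply: eq_bigr => q _ /=; rewrite mulr_sumr.
rewrite LE RE; apply: ler_sum => p _; apply: ler_sum => q _.
apply: ler_wpM2l; first exact: mulr_ge0.
have [pq|qp] := leqP p q.
  apply: ler_sum => k _; have [kp|kp] := leqP k p; last first.
    by rewrite mul0r big1// => l _; rewrite !mul0r.
  rewrite (leq_trans kp pq) mul1r (le_trans _ (Drow k))//.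
  by apply: ler_sum => l _; rewrite mul1r; case: leq; rewrite ?mul1r ?mul0r.
rewrite exchange_big; apply: ler_sum => l _ /=; have [lq|lq] := leqP l q; last first.
  by rewrite mulr0 big1// => k _; rewrite mulr0 mul0r.
rewrite (leq_trans lq (ltnW qp)) mul1r (le_trans _ (Dcol l))//.
by apply: ler_sum => k _; rewrite mulr1; case: leq; rewrite ?mul1r ?mul0r.
Qed.

(** * Rectangular diagonal matrices, the trace inequality and sorted decompositions *)

Section Rectangular.
Variables (m n : nat) (mn : (m <= n)%N).
Implicit Types (U : 'M[F]_m) (V : 'M[F]_n) (s : 'I_m -> F).
Let w := widen_ord mn.

Definition rect_diag s : 'M[F]_(m, n) :=
  \matrix_(i, j) if i == j :> nat then s i else 0.

Lemma mul_rect_diag s p (A : 'M[F]_(n, p)) k j :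
  (rect_diag s *m A) k j = s k * A (w k) j.
Proof.
rewrite mxE (bigD1 (w k))//= mxE eqxx big1 ?addr0// => l lk.
by rewrite mxE ifN ?mul0r//; apply: contra lk => /eqP kl; apply/eqP/val_inj.
Qed.

Lemma mul_rect_diag_tr s p (A : 'M[F]_(p, n)) i l :
  (A *m (rect_diag s)^T) i l = A i (w l) * s l.
Proof. by rewrite -[A]trmxK -trmx_mul mxE mul_rect_diag mulrC [A^T^T _ _]mxE. Qed.

Lemma svd_entry U s V i j :
  (U *m rect_diag s *m V^T) i j = \sum_k U i k * s k * V j (w k).
Proof.
rewrite -mulmxA mxE; apply: eq_bigr => k _.
by rewrite mul_rect_diag mxE mulrA.
Qed.

(** Cyclicity of the trace brings the orthogonal factors together, so they enter only through
    [U^T U'] and the leading block of [V^T V']. *)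
Lemma trace_svd U s V U' s' V' :
  \tr ((U *m rect_diag s *m V^T) *m (U' *m rect_diag s' *m V'^T)^T)
  = \sum_k \sum_l s k * s' l * ((U^T *m U') k l * (V^T *m V') (w k) (w l)).
Proof.
rewrite !trmx_mul trmxK -!mulmxA mxtrace_mulC -!mulmxA.
rewrite /mxtrace; apply: eq_bigr => k _.
rewrite mul_rect_diag.
rewrite mulmxA mulmxA mxE mulr_sumr; apply: eq_bigr => l _.
rewrite mul_rect_diag_tr.
have -> : (U'^T *m U) l k = (U^T *m U') k l.
  by rewrite -[in RHS](trmxK U') -trmx_mul [RHS]mxE.
by ring.
Qed.

Lemma orthomx_row_sqsum p (U : 'M[F]_p) k : U *m U^T = 1%:M -> \sum_l U k l ^+ 2 = 1.
Proof.
move=> /matrixP/(_ k k); rewrite !mxE eqxx mulr1n => <-.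
by apply: eq_bigr => l _; rewrite mxE expr2.
Qed.

Lemma orthomx_mul_tr p (U U' : 'M[F]_p) : U^T *m U = 1%:M -> U'^T *m U' = 1%:M ->
  (U^T *m U') *m (U^T *m U')^T = 1%:M.
Proof.
by move=> U1 /mulmx1C U1'; rewrite trmx_mul trmxK mulmxA -(mulmxA U^T) U1' mulmx1.
Qed.

Lemma sqsum_widen (G : 'I_n -> F) : \sum_(k < m) G (w k) ^+ 2 <= \sum_l G l ^+ 2.
Proof.
rewrite [leRHS](bigID (fun l : 'I_n => (l < m)%N)) /= big_ord_narrow.
by rewrite lerDl sumr_ge0// => l _; exact: sqr_ge0.
Qed.

(** In [trace_svd], each product of entries of the orthogonal matrices [P] and [Q] is at most the
    mean of their squares. The squares in a row or column of [P] sum to [1], those in the leading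
    block of [Q] to at most [1], so the means form a doubly substochastic matrix. *)
Lemma von_Neumann_trace U s V U' s' V' :
  U^T *m U = 1%:M -> V^T *m V = 1%:M -> U'^T *m U' = 1%:M -> V'^T *m V' = 1%:M ->
  (forall i j : 'I_m, (i <= j)%N -> s j <= s i) -> (forall i, 0 <= s i) ->
  (forall i j : 'I_m, (i <= j)%N -> s' j <= s' i) -> (forall i, 0 <= s' i) ->
  \tr ((U *m rect_diag s *m V^T) *m (U' *m rect_diag s' *m V'^T)^T)
  <= \sum_k s k * s' k.
Proof.
move=> U1 V1 U1' V1' sd s0 sd' s0'; rewrite trace_svd.
set P := U^T *m U'; set Q := V^T *m V'.
have PP : P *m P^T = 1%:M by exact: orthomx_mul_tr.
have QQ : Q *m Q^T = 1%:M by exact: orthomx_mul_tr.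
have PT : P^T *m P^T^T = 1%:M by rewrite trmxK; exact: mulmx1C.
have QT : Q^T *m Q^T^T = 1%:M by rewrite trmxK; exact: mulmx1C.
pose D k l := (P k l ^+ 2 + Q (w k) (w l) ^+ 2) / 2.
apply: (@le_trans _ _ (\sum_k \sum_l s k * s' l * D k l)).
  apply: ler_sum => k _; apply: ler_sum => l _; apply: ler_wpM2l; first exact: mulr_ge0.
  rewrite /D; have := sqr_ge0 (P k l - Q (w k) (w l)).
  by move: (P k l) (Q _ _) => x y; nra.
apply: substochastic_rearrangement => //.
- by move=> k l; rewrite divr_ge0// addr_ge0 ?sqr_ge0.
- move=> k; rewrite -mulr_suml big_split /= orthomx_row_sqsum//.
  have := sqsum_widen (fun l => Q (w k) l); rewrite orthomx_row_sqsum// => h; lra.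
- move=> k; rewrite -mulr_suml big_split /=.
  have hQ : \sum_l Q (w l) (w k) ^+ 2 <= 1.
    rewrite -(orthomx_row_sqsum (w k) QT) (le_trans _ (sqsum_widen _))//.
    by apply: ler_sum => l _; rewrite [Q^T _ _]mxE.
  have -> : \sum_l P l k ^+ 2 = 1.
    by rewrite -(orthomx_row_sqsum k PT); apply: eq_bigr => l _; rewrite [P^T _ _]mxE.
  lra.
Qed.

Lemma trace_svd_same U s V s' : U^T *m U = 1%:M -> V^T *m V = 1%:M ->
  \tr ((U *m rect_diag s *m V^T) *m (U *m rect_diag s' *m V^T)^T)
  = \sum_k s k * s' k.
Proof.
move=> U1 V1; rewrite trace_svd U1 V1; apply: eq_bigr => k _.
rewrite (bigD1 k)//= !mxE !eqxx !mulr1 big1 ?addr0// => l lk.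
by rewrite mxE eq_sym (negbTE lk) mul0r mulr0.
Qed.

Lemma sorting_perm s :
  exists p : 'S_m, forall i j : 'I_m, (i <= j)%N -> s (p j) <= s (p i).
Proof.
pose t := [tuple s i | i < m].
have /tuple_permP[p pE] : perm_eq (sort >=%O t) t by rewrite perm_sort.
exists p => i j ij.
have tE k : s (p k) = nth 0 (sort >=%O t) k.
  by rewrite pE -(tnth_nth 0 [tuple tnth t (p i) | i < m]) !tnth_mktuple.
rewrite !tE; apply: (@sorted_leq_nth _ (>=%O : rel F)) => //.
- by move=> x y z /= xy yz; exact: le_trans yz xy.
- by move=> x /=.
- by apply: sort_sorted => x y; exact: le_total.
- by rewrite inE size_sort size_tuple.
- by rewrite inE size_sort size_tuple.
Qed.

(** Lets the columns of the right factor follow a reordering of the singular values; the indices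
    from [m] on stay fixed. *)
Lemma perm_widen (p : 'S_m) : exists q : 'S_n, forall k, q (w k) = w (p k).
Proof.
pose f (l : 'I_n) := if insub (l : nat) is Some k then w (p k) else l.
have fw k : f (w k) = w (p k) by rewrite /f /= valK.
have finj : injective f.
  move=> x y; rewrite /f.
  case: insubP => [k _ kx|xm]; case: insubP => [l _ ly|ym].
  - move/(congr1 val) => /= /val_inj/perm_inj kl.
    by apply/val_inj; rewrite /= -kx -ly kl.
  - by move/(congr1 val) => /= E; rewrite -E ltn_ord in ym.
  - by move/(congr1 val) => /= E; rewrite E ltn_ord in xm.
  - by [].
by exists (perm finj) => k; rewrite permE fw.
Qed.

Lemma col_perm_ortho q (p : 'S_q) (U : 'M[F]_q) :
  U^T *m U = 1%:M -> (col_perm p U)^T *m col_perm p U = 1%:M.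
Proof.
move=> /matrixP U1; apply/matrixP => i j; have := U1 (p i) (p j).
rewrite !mxE (inj_eq perm_inj) => <-; by apply: eq_bigr => k _; rewrite !mxE.
Qed.

(** Permuting the singular values together with the matching columns of both factors only reindexes
    the sum in [svd_entry]. *)
Lemma SVD_sorted (X : 'M[F]_(m, n)) : exists U s V,
  [/\ U^T *m U = 1%:M, V^T *m V = 1%:M,
   forall i j : 'I_m, (i <= j)%N -> s j <= s i, forall i, 0 <= s i
   & X = U *m rect_diag s *m V^T].
Proof.
have [U [V [U1 V1 D0 Dp]]] := SVD X mn.
pose s k := (U *m X *m V^T) k (w k).
have XE : X = U^T *m rect_diag s *m V^T^T.
  have <- : U *m X *m V^T = rect_diag s.
    apply/matrixP => i j; rewrite [RHS]mxE; case: eqP => [ij|/eqP/D0//].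
    by congr ((_ *m _) _ _); apply/val_inj.
  by rewrite !mulmxA (mulmx1C U1) mul1mx trmxK -mulmxA (mulmx1C V1) mulmx1.
have [p pd] := sorting_perm s.
have [q qw] := perm_widen p.
exists (col_perm p U^T), (fun k => s (p k)), (col_perm q V^T); split=> //.
- by apply: col_perm_ortho; rewrite trmxK.
- by apply: col_perm_ortho; rewrite trmxK.
- by move=> k; exact: Dp.
rewrite [LHS]XE; apply/matrixP => i j; rewrite !svd_entry.
rewrite (reindex_inj (@perm_inj _ p)) /=; apply: eq_bigr => k _.
by rewrite [col_perm p _ _ _]mxE [col_perm q _ _ _]mxE qw.
Qed.

End Rectangular.
End SVD.

(** * Singular values of function-valued matrices *)

Section MatSVD.
Local Open Scope ring_scope.
Variables (n1 n2 : nat) (Hn : (n1 <= n2)%N).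
Implicit Types (X W : Mat n1 n2) (U : Mat n1 n1) (V : Mat n2 n2) (s : 'I_n1 -> R).

Definition mx_of m n (A : Mat m n) : 'M[R]_(m, n) := \matrix_(i, j) A i j.

Lemma mx_of_svd_recon U s V :
  mx_of (svd_recon U s V) = mx_of U *m rect_diag n2 s *m (mx_of V)^T.
Proof.
apply/matrixP => i j; rewrite (svd_entry Hn) mxE; apply: eq_bigr => k _.
transitivity (\sum_(l < n2) U i k * (if k == l :> nat then s k else 0) * V j l) => //.
rewrite (bigD1 (widen_ord Hn k))//= eqxx big1 ?addr0; first by rewrite !mxE.
move=> l lk; rewrite ifN ?mulr0 ?mul0r//.
by apply: contra lk => /eqP kl; apply/eqP/val_inj.
Qed.

Lemma mx_of_orthogonal n (U : Mat n n) :
  orthogonal U <-> (mx_of U)^T *m mx_of U = 1%:M.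
Proof.
have E i j : ((mx_of U)^T *m mx_of U) i j = msum (fun k => (U k i * U k j)).
  by rewrite mxE; apply: eq_bigr => k _; rewrite !mxE.
split=> [oU|/matrixP oU i j].
  by apply/matrixP => i j; rewrite E oU mxE; case: (i == j).
by rewrite -E oU mxE; case: (i == j).
Qed.

Lemma mx_of_frob_inner m n (A B : Mat m n) :
  frob_inner A B = \tr (mx_of A *m (mx_of B)^T).
Proof.
apply: eq_bigr => i _; rewrite mxE; apply: eq_bigr => j _.
by rewrite !mxE.
Qed.

(** Ensures that the [epsilon] in [svd_of] picks a genuine decomposition. *)
Lemma svd_exists X : exists p : svd_triple n1 n2, is_svd X p.1.1 p.1.2 p.2.
Proof.
have [U [s [V [U1 V1 sd s0 XE]]]] := SVD_sorted Hn (mx_of X).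
have mxK m n (A : 'M[R]_(m, n)) : mx_of (fun i j => A i j) = A.
  by apply/matrixP => i j; rewrite mxE.
exists ((fun i j => U i j, fun i j => V i j), s); split; [|split; [|split; [|split]]] => /=.
- by apply/mx_of_orthogonal; rewrite mxK.
- by apply/mx_of_orthogonal; rewrite mxK.
- by move=> i j ij; apply/RleP/sd.
- by move=> i; apply/RleP.
have : mx_of X = mx_of (svd_recon (fun i j => U i j) s (fun i j => V i j)).
  by rewrite mx_of_svd_recon !mxK.
move=> /matrixP h; apply: functional_extensionality => i.
by apply: functional_extensionality => j; have := h i j; rewrite !mxE.
Qed.

Lemma svd_ofP X : is_svd X (svd_of X).1.1 (svd_of X).1.2 (svd_of X).2.
Proof. exact: (epsilon_spec _ _ (svd_exists X)). Qed.

Lemma frob_inner_le_svd X U V s W U' V' s' :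
  is_svd X U V s -> is_svd W U' V' s' ->
  Rle (frob_inner X W) (msum (fun k => Rmult (s k) (s' k))).
Proof.
move=> [U1 [V1 [sd [s0 ->]]]] [U1' [V1' [sd' [s0' ->]]]].
rewrite mx_of_frob_inner !mx_of_svd_recon; apply/RleP.
apply: (von_Neumann_trace Hn); try exact/mx_of_orthogonal.
- by move=> i j ij; apply/RleP/sd.
- by move=> i; apply/RleP.
- by move=> i j ij; apply/RleP/sd'.
- by move=> i; apply/RleP.
Qed.

Lemma frob_inner_svd U V s s' : orthogonal U -> orthogonal V ->
  frob_inner (svd_recon U s V) (svd_recon U s' V) = msum (fun k => Rmult (s k) (s' k)).
Proof.
move=> /mx_of_orthogonal U1 /mx_of_orthogonal V1.
by rewrite mx_of_frob_inner !mx_of_svd_recon (trace_svd_same Hn).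
Qed.

(* Both decompositions have squared norm [<X, X>], and the trace inequality bounds it by
   [\sum_k s k * s' k]; hence [\sum_k (s k - s' k)^2 <= 0]. *)
Lemma svd_unique X U V s U' V' s' :
  is_svd X U V s -> is_svd X U' V' s' -> s =1 s'.
Proof.
move=> svdX svdX'; have le := frob_inner_le_svd svdX svdX'.
have [U1 [V1 [_ [_ XE]]]] := svdX; have [U1' [V1' [_ [_ XE']]]] := svdX'.
have E : frob_inner X X = \sum_k s k * s k by rewrite XE frob_inner_svd.
have E' : frob_inner X X = \sum_k s' k * s' k by rewrite XE' frob_inner_svd.
have : \sum_k (s k - s' k) ^+ 2 <= 0.
  have -> : \sum_k (s k - s' k) ^+ 2
      = \sum_k s k * s k + \sum_k s' k * s' k - (\sum_k s k * s' k) *+ 2.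
    rewrite -sumrMnl -sumrN -!big_split /=; apply: eq_bigr => k _.
    by rewrite sqrrB addrAC !expr2.
  by rewrite -E -E' -mulr2n subr_le0 lerMn2r; apply/orP; right; apply/RleP.
have sq0 k : true -> 0 <= (s k - s' k) ^+ 2 by rewrite sqr_ge0.
rewrite le_eqVlt ltNge sumr_ge0//= orbF psumr_eq0// => /allP h k.
have := h k (mem_index_enum _); rewrite sqrf_eq0 subr_eq0.
by move/eqP.
Qed.

(** Frees [sing] from the choice made by [epsilon]: singular values can be read off any explicitly
    built decomposition. *)
Lemma sing_svd X U V s : is_svd X U V s -> sing X =1 s.
Proof. by move=> h; exact: svd_unique (svd_ofP X) h. Qed.

Lemma sing_ge0 X k : Rle 0 (sing X k).
Proof. by have [_ [_ [_ [h _]]]] := svd_ofP X; exact: h. Qed.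

Lemma sing_le_spec_norm X k : Rle (sing X k) (spec_norm X).
Proof.
rewrite /spec_norm; move: (mem_index_enum k); elim: (index_enum _) => // i r IH.
rewrite inE big_cons => /orP[/eqP->|/IH le]; first exact: Rmax_l.
exact: Rle_trans le (Rmax_r _ _).
Qed.

Lemma spec_norm_le X c : Rle 0 c -> (forall k, Rle (sing X k) c) -> Rle (spec_norm X) c.
Proof.
by move=> c0 h; rewrite /spec_norm; apply: (big_ind (Rle^~ c)) => // x y; exact: Rmax_lub.
Qed.

Lemma frob_inner_le_sing X W :
  Rle (frob_inner W X) (msum (fun k => Rmult (sing W k) (sing X k))).
Proof. exact: frob_inner_le_svd (svd_ofP W) (svd_ofP X). Qed.

(** With shared singular vectors the Frobenius norm is the Euclidean norm of [s - s'], which for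
    nonnegative entries is at most their sum. *)
Lemma frob_norm_svd_recon_sub U V s s' : orthogonal U -> orthogonal V ->
  (forall k, Rle (s' k) (s k)) ->
  Rle (frob_norm (msub (svd_recon U s V) (svd_recon U s' V)))
      (msum (fun k => Rminus (s k) (s' k))).
Proof.
move=> U1 V1 s's; rewrite /frob_norm.
have -> : msub (svd_recon U s V) (svd_recon U s' V) = svd_recon U (fun k => Rminus (s k) (s' k)) V.
  apply: functional_extensionality => i; apply: functional_extensionality => j.
  pose G (t : 'I_n1 -> R) k (l : 'I_n2) : R := U i k * (if k == l :> nat then t k else 0) * V j l.
  transitivity (\sum_k \sum_l G s k l - \sum_k \sum_l G s' k l) => //.
  rewrite -sumrB.
  apply: eq_bigr => k _; rewrite -sumrB; apply: eq_bigr => l _.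
  transitivity (G (fun k => s k - s' k) k l) => //.
  by rewrite /G; case: eqP => _; rewrite ?mulr0 ?mul0r ?subr0// -mulrBl -mulrBr.
rewrite frob_inner_svd//; set d := (fun k => Rminus (s k) (s' k)).
have d0 k : 0 <= d k by rewrite -[d k]/(s k - s' k) subr_ge0; apply/RleP.
have sum_ge0 : 0 <= \sum_k d k by rewrite sumr_ge0.
rewrite RsqrtE; apply/RleP.
rewrite -[msum d]/(\sum_k d k) -[msum _]/(\sum_k d k * d k).
rewrite -(ger0_norm sum_ge0) -sqrtr_sqr ler_sqrt ?sqr_ge0//.
rewrite expr2 mulr_suml; apply: ler_sum => k _; apply: ler_wpM2l => //.
by rewrite (bigD1 k)//= lerDl sumr_ge0.
Qed.

End MatSVD.

(** * Penalization *)

Lemma msum_le n (F G : 'I_n -> R) : (forall k, F k <= G k) -> msum F <= msum G.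
Proof.
move=> FG; apply: (big_ind2 Rle) => //; first exact: Rle_refl.
by move=> *; exact: Rplus_le_compat.
Qed.

Lemma msum_eq n (F G : 'I_n -> R) : (forall k, F k = G k) -> msum F = msum G.
Proof. by move=> FG; apply: eq_bigr. Qed.

Lemma msumD n (F G : 'I_n -> R) : msum (fun k => F k + G k) = msum F + msum G.
Proof. exact: big_split. Qed.

Lemma msumZ n c (F : 'I_n -> R) : msum (fun k => c * F k) = c * msum F.
Proof. by rewrite /msum big_distrr. Qed.

Lemma msum_ge0 n (F : 'I_n -> R) : (forall k, 0 <= F k) -> 0 <= msum F.
Proof.
move=> F0; apply: (big_ind (Rle 0)) => //; first exact: Rle_refl.
by move=> *; exact: Rplus_le_le_0_compat.
Qed.

Lemma rank_le n1 n2 (X : Mat n1 n2) : INR (rank X) <= INR n1.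
Proof. by apply/le_INR/ssrnat.leP/bigmax_leqP => r _; rewrite -ltnS. Qed.

(** Otherwise the chord from [t] to [1] has slope [q > d]. By convexity chords starting closer to
    [1] have slope at least [q], whereas near [1] their slope is below [d + (q - d) = q]. *)
Lemma left_deriv_support phi d t : convex_on01 phi -> is_left_deriv_at1 phi d ->
  in01 t -> rpart (phi 1) + d * (t - 1) <= rpart (phi t).
Proof.
move=> cvx der t01; have [t0 t1] := t01.
case: (Req_dec t 1) => [->|tn1]; first lra.
have tlt : 0 < 1 - t by lra.
apply: Rnot_lt_le => lt; set q := (rpart (phi 1) - rpart (phi t)) / (1 - t).
have qE : q * (1 - t) = rpart (phi 1) - rpart (phi t) by rewrite /q; field; lra.
have dq : q - d > 0.
  apply: Rlt_gt; apply: (Rmult_lt_reg_r (1 - t)) => //; lra.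
have [del [del0 near1]] := der _ dq.
(* This weight satisfies both [0 < l < 1] and [l * (1 - t) < del], so [u = l * t + (1 - l)] falls
   within [del] of [1]. *)
set l := del / (del + (1 - t)).
have lE : l * (del + (1 - t)) = del by rewrite /l; field; lra.
have l0 : 0 < l by apply: Rdiv_lt_0_compat; lra.
have l1 : l < 1 by nra.
have lt1 : 0 < l * (1 - t) < del by nra.
have := cvx t 1 l t01 (conj Rle_0_1 (Rle_refl 1)) (conj (Rlt_le _ _ l0) (Rlt_le _ _ l1)).
set u := (l * t + _); have uE : 1 - u = l * (1 - t) by rewrite /u; lra.
move=> cvxu; have [|_] := near1 u; first lra.
set k := (_ / (u - 1)) => /Rabs_def2 [kd _].
have kE : k * (1 - u) = rpart (phi 1) - rpart (phi u) by rewrite /k; field; lra.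
have : q * (1 - u) <= k * (1 - u).
  rewrite kE uE; have -> : q * (l * (1 - t)) = l * (q * (1 - t)) by ring.
  rewrite qE; lra.
have : k * (1 - u) < q * (1 - u) by apply: Rmult_lt_compat_r; lra.
lra.
Qed.

Lemma psi_of_in01 phi t : in01 t -> psi_of phi t = phi t.
Proof.
move=> [ge0 le1]; rewrite /psi_of.
by case: (Rle_dec 0 t) => //; case: (Rle_dec t 1).
Qed.

(** * Scalar bounds for a single singular value *)

Section PenaltyTerm.
Variables (phi : R -> ereal) (tstar t0 d : R).
Hypotheses (Hphi : in_Phi phi tstar) (Hd : is_left_deriv_at1 phi d)
  (Ht0 : 0 <= t0 < 1) (Hsub : in_subdiff (psi_of phi) t0 (1 / (1 - tstar))).

Lemma Phi_ge0 t : in01 t -> 0 <= rpart (phi t).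
Proof.
case: Hphi => _ [_ [_ [_ [_ [_ [ge0 _]]]]]] /ge0.
by case: (phi t) => //= _; exact: Rle_refl.
Qed.

Lemma Phi_support1 t : in01 t -> 1 - d * (1 - t) <= rpart (phi t).
Proof.
case: Hphi => _ [_ [_ [cvx [_ [_ [_ p1]]]]]] t01.
have := left_deriv_support cvx Hd t01; rewrite p1 /=; lra.
Qed.

(** The support line at [1] is evaluated at [tstar], where [phi] vanishes. In particular [d > 0],
    which makes [rhobar] positive. *)
Lemma left_deriv_ge : 1 <= d * (1 - tstar).
Proof.
case: Hphi => _ [_ [_ [_ [ts [p0 _]]]]].
by have := @Phi_support1 tstar (conj (proj1 ts) (Rlt_le _ _ (proj2 ts))); rewrite p0 /=; lra.
Qed.

(** This is the subgradient inequality at [t0] multiplied by [1 - tstar], with the nonnegative term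
    in [phi t0] dropped. *)
Lemma Phi_support_t0 t : in01 t -> t - t0 <= (1 - tstar) * rpart (phi t).
Proof.
move=> t01; have t0p := Phi_ge0 (conj (proj1 Ht0) (Rlt_le _ _ (proj2 Ht0))).
case: Hphi => _ [_ [_ [_ [ts _]]]].
have := proj2 Hsub t.
rewrite !psi_of_in01//; last by split; lra.
have fin : phi t <> PInf.
  case: Hphi => _ [_ [dom _]]; have [e [e0 h]] := dom t t01; apply: h.
  by rewrite Rminus_diag Rabs_R0.
case: (phi t) fin => //= x _ le.
have : (1 - tstar) * (rpart (phi t0) + 1 / (1 - tstar) * (t - t0)) <= (1 - tstar) * x.
  by apply: Rmult_le_compat_l; lra.
have -> : (1 - tstar) * (rpart (phi t0) + 1 / (1 - tstar) * (t - t0))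
    = (1 - tstar) * rpart (phi t0) + (t - t0) by field; lra.
have : 0 <= (1 - tstar) * rpart (phi t0) by apply: Rmult_le_pos; lra.
lra.
Qed.

Lemma penalty_term_large a w : in01 w -> d < a -> 1 <= rpart (phi w) + a * (1 - w).
Proof.
move=> w01 da; have := Phi_support1 w01; case: w01 => w0 w1.
have : d * (1 - w) <= a * (1 - w) by apply: Rmult_le_compat_r; lra.
lra.
Qed.

(* [k <= a] settles [w <= t0]; [k (1 - tstar) <= 1] and the subgradient inequality at [t0]
   settle [w > t0]. *)
Lemma penalty_term_small a k w : in01 w -> 0 <= a <= d ->
  k * (d * (1 - tstar)) = a -> k * (1 - t0) <= rpart (phi w) + a * (1 - w).
Proof.
move=> w01 [a0 ad] kE; have d1 := left_deriv_ge; have p0 := Phi_ge0 w01.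
have sub := Phi_support_t0 w01; case: w01 => w0 w1.
case: Hphi => _ [_ [_ [_ [ts _]]]].
have k0 : 0 <= k by apply: Rnot_lt_le => k0; nra.
have ka : k <= a by rewrite -kE -{1}(Rmult_1_r k); apply: Rmult_le_compat_l.
have d0 : 0 < d by nra.
have kt : k * (1 - tstar) <= 1.
  apply: (Rmult_le_reg_l d) => //; lra.
case: (Rle_dec w t0) => [wt|/Rnot_le_lt tw].
  have : k * (1 - t0) <= a * (1 - w).
    by apply: Rmult_le_compat => //; lra.
  lra.
have h1 : k * (w - t0) <= rpart (phi w).
  apply: (Rle_trans _ (k * ((1 - tstar) * rpart (phi w)))).
    exact: Rmult_le_compat_l.
  rewrite -Rmult_assoc -{2}(Rmult_1_l (rpart _)).
  exact: Rmult_le_compat_r.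
have h2 : k * (1 - w) <= a * (1 - w) by apply: Rmult_le_compat_r; lra.
lra.
Qed.

End PenaltyTerm.

(** * From singular values to the penalized matrix problem *)

Lemma is_svd_recon n1 n2 (U : Mat n1 n1) (V : Mat n2 n2) (s : 'I_n1 -> R) :
  orthogonal U -> orthogonal V ->
  (forall i j : 'I_n1, (i <= j)%N -> s j <= s i) -> (forall i, 0 <= s i) ->
  is_svd (svd_recon U s V) U V s.
Proof. by []. Qed.

Lemma sing_in01 n1 n2 (Hn : (n1 <= n2)%N) (W : Mat n1 n2) k :
  spec_norm W <= 1 -> in01 (sing W k).
Proof.
by move=> W1; split; [exact: sing_ge0 | exact: Rle_trans (sing_le_spec_norm W k) W1].
Qed.

Lemma duality_gap_ge n1 n2 (Hn : (n1 <= n2)%N) (X W : Mat n1 n2) :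
  msum (fun k => sing X k * (1 - sing W k)) <= nuc_norm X - frob_inner W X.
Proof.
have := frob_inner_le_sing Hn X W; rewrite /nuc_norm.
have -> : msum (sing X) = msum (fun k => sing X k * (1 - sing W k))
    + msum (fun k => sing W k * sing X k).
  by rewrite -msumD; apply: msum_eq => k; ring.
lra.
Qed.

(** The zero matrix serves as [W]; writing it with the singular vectors of [X] makes its singular
    values explicit. *)
Lemma exists_feasP n1 n2 (Hn : (n1 <= n2)%N) (Om : Mat n1 n2 -> Prop) X :
  Om X -> exists W, feasP Om X W.
Proof.
move=> OmX; have [U1 [V1 _]] := svd_ofP Hn X.
have svd0 : is_svd (svd_recon (svd_of X).1.1 (fun _ => 0) (svd_of X).1.2)
    (svd_of X).1.1 (svd_of X).1.2 (fun _ => 0).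
  by apply: is_svd_recon => // *; exact: Rle_refl.
exists (svd_recon (svd_of X).1.1 (fun _ => 0) (svd_of X).1.2).
split=> //; apply: spec_norm_le; first exact: Rle_0_1.
by move=> k; rewrite (sing_svd Hn svd0); exact: Rle_0_1.
Qed.

Section Penalization.
Variables (n1 n2 : nat) (Hn : (n1 <= n2)%N) (phi : R -> ereal) (tstar t0 d : R).
Hypotheses (Hphi : in_Phi phi tstar) (Hd : is_left_deriv_at1 phi d)
  (Ht0 : 0 <= t0 < 1) (Hsub : in_subdiff (psi_of phi) t0 (1 / (1 - tstar))).
Variables (nu : R) (f : Mat n1 n2 -> ereal) (Om : Mat n1 n2 -> Prop) (Lf : R).
Hypotheses (Hnu : nu > 0) (HLf : Lf > 0) (Hlip : lipschitz_rel f Om Lf)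
  (Hrho : forall X rho, Om X -> rho > 0 -> Om (Xrho d rho X)).

Let rhobar := d * (1 - tstar) / (1 - t0) * nu * Lf.

Lemma rhobar_gt0 : rhobar > 0.
Proof.
have d1 := left_deriv_ge Hphi Hd.
apply: Rmult_gt_0_compat HLf; apply: Rmult_gt_0_compat Hnu.
by apply: Rdiv_lt_0_compat; lra.
Qed.

Lemma feasP_gap_ge0 X W : feasP Om X W -> 0 <= nuc_norm X - frob_inner W X.
Proof.
move=> [_ W1]; apply: Rle_trans (duality_gap_ge Hn X W); apply: msum_ge0 => k.
have [] := sing_in01 Hn k W1 => w0 w1; apply: Rmult_le_pos; first exact: sing_ge0.
lra.
Qed.

(* The competitor is [X^rhobar] with [W'] sharing its singular vectors: [W'] has singular
   value [1] where [X^rhobar] keeps the one of [X], and [tstar] elsewhere. *)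
Lemma feasQ_below_penobj X W : feasP Om X W ->
  exists Y W', feasQ Om Y W' /\ objQ nu f phi Y W' <= penobj nu f phi rhobar X W.
Proof.
move=> [OmX W1]; have rho0 := rhobar_gt0.
have [U1 [V1 [xd [x0 XE]]]] := svd_ofP Hn X.
have [_ [_ [_ [_ [ts [pts [_ p1]]]]]]] := Hphi.
move: U1 V1 xd x0 XE; set U := (svd_of X).1.1; set V := (svd_of X).1.2.
rewrite -[(svd_of X).2]/(sing X) => U1 V1 xd x0 XE.
pose y k := if Rlt_dec d (rhobar * sing X k) then sing X k else 0.
pose w k := if Rlt_dec d (rhobar * sing X k) then 1 else tstar.
pose Y := svd_recon U y V; pose W' := svd_recon U w V.
(* The indices that pass the threshold form an initial segment, hence [y] and [w] are nonincreasing
   and give valid decompositions. *)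
have mono (i j : 'I_n1) : (i <= j)%N -> rhobar * sing X j <= rhobar * sing X i.
  by move=> ij; apply: Rmult_le_compat_l; [lra | exact: xd].
have svdY : is_svd Y U V y.
  apply: is_svd_recon => // [i j ij|i]; rewrite /y.
    have := mono i j ij; have := xd i j ij; have := x0 i.
    by case: Rlt_dec; case: Rlt_dec => /= *; lra.
  by have := x0 i; case: Rlt_dec => /= *; lra.
have svdW' : is_svd W' U V w.
  apply: is_svd_recon => // [i j ij|i]; rewrite /w.
    by have := mono i j ij; case: Rlt_dec; case: Rlt_dec => /= *; lra.
  by case: Rlt_dec => /= *; lra.
have singY := sing_svd Hn svdY; have singW' := sing_svd Hn svdW'.
have OmY : Om Y by exact: Hrho OmX rho0.
exists Y, W'; split.
  split=> //; split.
    apply: spec_norm_le; first exact: Rle_0_1.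
    by move=> k; rewrite singW' /w; case: Rlt_dec => /= *; lra.
  (* The gap vanishes since [w] is [1] wherever [y] may be nonzero. *)
  rewrite /nuc_norm (msum_eq singY) frob_inner_svd// (@msum_eq _ (fun k => _ * _) y).
    by lra.
  by move=> k; rewrite /w /y; case: Rlt_dec => /= *; lra.
have [fX [fY [fXE [fYE lip]]]] := Hlip OmX OmY.
rewrite /penobj /objQ fXE fYE /=.
have gap := duality_gap_ge Hn X W.
have yx k : y k <= sing X k by have := x0 k; rewrite /y; case: Rlt_dec => /= *; lra.
have frob := frob_norm_svd_recon_sub Hn U1 V1 yx; rewrite -XE -/Y in frob.
have {}lip : fY - fX <= Lf * msum (fun k => sing X k - y k).
  have : Lf * frob_norm (msub X Y) <= Lf * msum (fun k => sing X k - y k).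
    by apply: Rmult_le_compat_l; lra.
  have := Rle_abs (- (fX - fY)); rewrite Rabs_Ropp; lra.
(* A kept singular value costs [phi 1 = 1]; a dropped one costs [phi tstar = 0] plus its share
   [nu * Lf * sing X k] of the Lipschitz bound. *)
have term k : rpart (phi (w k)) + nu * Lf * (sing X k - y k)
    <= rpart (phi (sing W k)) + rhobar * (sing X k * (1 - sing W k)).
  have wk := sing_in01 Hn k W1; have xk := x0 k.
  rewrite -Rmult_assoc /w /y; case: Rlt_dec => [big|/Rnot_lt_le small] /=.
    by have := penalty_term_large Hphi Hd wk big; rewrite p1 /=; lra.
  have d1 := left_deriv_ge Hphi Hd.
  (* The equation that [penalty_term_small] requires between these two quantities is what determines
     the value of [rhobar]. *)
  have := @penalty_term_small _ _ _ _ Hphi Hd Ht0 Hsub (rhobar * sing X k)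
    (nu * Lf * sing X k / (1 - t0)) _ wk.
  rewrite pts /= => small'.
  have -> : nu * Lf * (sing X k - 0) = nu * Lf * sing X k / (1 - t0) * (1 - t0).
    by field; lra.
  rewrite Rplus_0_l; apply: small'.
    by split=> //; apply: Rmult_le_pos; lra.
  by rewrite /rhobar; field; lra.
have := msum_le term; rewrite !msumD !msumZ.
rewrite (@msum_eq _ (fun k => rpart (phi (sing W' k))) (fun k => rpart (phi (w k)))); last first.
  by move=> k; rewrite singW'.
have : rhobar * msum (fun k => sing X k * (1 - sing W k))
    <= rhobar * (nuc_norm X - frob_inner W X) by apply: Rmult_le_compat_l; lra.
have : nu * (fY - fX) <= nu * (Lf * msum (fun k => sing X k - y k)).
  by apply: Rmult_le_compat_l; lra.
lra.
Qed.

(** Optimality of [Xs] bounds [nu * f X] below by [nu * fs + rank Xs - rank X], the rank of [X] is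
    at most [n1], and the sum of the [phi] terms is nonnegative. *)
Lemma rank_min_objQ_bounded :
  (exists Xs, Om Xs /\ forall X, Om X -> ereal_le (rank_obj nu f Xs) (rank_obj nu f X)) ->
  exists B, forall X W, feasQ Om X W -> B <= objQ nu f phi X W.
Proof.
move=> [Xs [OmXs min]]; have [fs [_ [fsE _]]] := Hlip OmXs OmXs.
exists (nu * fs - INR n1) => X W [OmX [W1 _]].
have [fX [_ [fXE _]]] := Hlip OmX OmX.
have := min X OmX; rewrite /rank_obj /objQ fXE fsE /=.
have := rank_le X; have := pos_INR (rank Xs).
have : 0 <= msum (fun i => rpart (phi (sing W i))).
  by apply: msum_ge0 => k; apply: Phi_ge0 Hphi _ (sing_in01 Hn k W1).
lra.
Qed.

End Penalization.

Lemma optval_Q_exists n1 n2 nu f phi (Om : Mat n1 n2 -> Prop) :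
  (exists X W, feasQ Om X W) ->
  (exists B, forall X W, feasQ Om X W -> B <= objQ nu f phi X W) ->
  exists v, is_optval_Q nu f phi Om v.
Proof.
move=> [X0 [W0 feas0]] [B HB].
have [||m [ub lub]] := completeness (fun r => exists X W, feasQ Om X W /\ r = - objQ nu f phi X W).
- by exists (- B) => r [X [W [feas ->]]]; have := HB _ _ feas; lra.
- by exists (- objQ nu f phi X0 W0), X0, W0.
(* [completeness] yields suprema, so the infimum is minus the supremum [m] of the negated
   objective. *)
exists (- m); split=> [X W feas|eps eps0].
  by have := ub (- objQ nu f phi X W) (ex_intro _ X (ex_intro _ W (conj feas erefl))); lra.
apply: NNPP => none; have : m <= m - eps; last by lra.
apply: lub => r [X [W [feas ->]]]; apply: Rnot_lt_le => lt.
by apply: none; exists X, W; split=> //; lra.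
Qed.

Theorem theorem4p2
  (n1 n2 : nat) (Hn : (n1 <= n2)%N)
  (phi : R -> ereal) (tstar t0 dphi1 : R)
  (Hphi : in_Phi phi tstar)
  (Hdphi : is_left_deriv_at1 phi dphi1)
  (Ht0 : 0 <= t0 < 1)
  (Hsub : in_subdiff (psi_of phi) t0 (1 / (1 - tstar)))
  (nu : R) (Hnu : nu > 0)
  (f : Mat n1 n2 -> ereal) (Hfp : proper_M f) (Hfl : lsc_M f)
  (Om : Mat n1 n2 -> Prop) (HOm : closed_mset Om)
  (Hsol : exists Xs, Om Xs /\
     forall X, Om X -> ereal_le (rank_obj nu f Xs) (rank_obj nu f X))
  (Lf : R) (HLf : Lf > 0) (Hlip : lipschitz_rel f Om Lf)
  (Hrho : forall X rho, Om X -> rho > 0 -> Om (Xrho dphi1 rho X)) :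
  let rhobar := dphi1 * (1 - tstar) / (1 - t0) * nu * Lf in
  (exists v, is_optval_Q nu f phi Om v /\
     forall X W, feasP Om X W -> v <= penobj nu f phi rhobar X W) /\
  (forall rho, rho > rhobar ->
     forall X W, optP nu f phi Om rho X W <-> optQ nu f phi Om X W).
Proof.
move=> rhobar.
have below X W : feasP Om X W ->
    exists Y W', feasQ Om Y W' /\ objQ nu f phi Y W' <= penobj nu f phi rhobar X W.
  exact: feasQ_below_penobj.
have feasQP X W : feasQ Om X W -> feasP Om X W by case=> ? [].
have penQ r X W : feasQ Om X W -> penobj nu f phi r X W = objQ nu f phi X W.
  by move=> [_ [_ gap]]; rewrite /penobj gap; lra.
split.
  have [Xs [OmXs _]] := Hsol; have [Ws /below [Y [W [feasY _]]]] := exists_feasP Hn OmXs.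
  have [||v vP] := @optval_Q_exists n1 n2 nu f phi Om.
  - by exists Y, W.
  - exact: (rank_min_objQ_bounded Hn Hphi Hlip Hsol).
  exists v; split=> // X W' /below [Y' [W'' [feas le]]].
  exact: Rle_trans (vP.1 _ _ feas) le.
move=> rho rho_gt X W; split=> [[feas opt]|[feas opt]].
  have [Y [W' [feasY le]]] := below _ _ feas.
  have gap0 := feasP_gap_ge0 Hn feas.
  have := opt _ _ (feasQP _ _ feasY); rewrite (penQ _ _ _ feasY) => opt'.
  (* With a positive gap, the penalized value at [rho] would strictly exceed the one at [rhobar],
     hence the value at the feasible pair [(Y, W')], against optimality. *)
  have gapE : nuc_norm X - frob_inner W X = 0.
    case: gap0 => [gap|//]; exfalso.
    have := Rmult_lt_compat_r _ _ _ gap rho_gt.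
    by move: opt' le; rewrite /penobj; lra.
  have feasX : feasQ Om X W by case: feas.
  split=> // X' W'' feas'.
  by have := opt _ _ (feasQP _ _ feas'); rewrite !penQ.
split=> [|X' W' feas']; first exact: feasQP.
(* The chain runs from the value at [(X, W)] to that at [(Y, W'')], then to the penalized values of
   [(X', W')] at [rhobar] and at [rho]; the last comparison uses the nonnegative gap. *)
have [Y [W'' [feasY le]]] := below _ _ feas'.
rewrite penQ//; apply: Rle_trans (opt _ _ feasY) _; apply: (Rle_trans _ _ _ le).
apply: Rplus_le_compat_l; apply: Rmult_le_compat_r; first exact: feasP_gap_ge0 feas'.
exact: Rlt_le.
Qed.
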